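(* The ring $\mathcal{R}=\frac{GR(p^a,m)[x]}{\langle f(x)\rangle}$ has simple socle, with $\mathrm{soc}(\mathcal{R})=\langle p^{a-1}h(x)^{t-1}+\langle f\rangle\rangle$.
   Context: $p$ is a prime, $a,m\ge 1$; $GR(p^a,m)$ is the Galois ring of characteristic $p^a$ with $p^{am}$ elements, a local ring with maximal ideal $\langle p\rangle$ and residue field $\mathbb{F}_{p^m}$. A bar denotes reduction modulo $p$ (applied coefficientwise to polynomials). $\mathcal{T}_m=\{0,1,\zeta,\dots,\zeta^{p^m-2}\}\subset GR(p^a,m)$ is the Teichmüller set ($\zeta$ of multiplicative order $p^m-1$), identified with $\mathbb{F}_{p^m}$. A polynomial in $GR(p^a,m)[x]$ is regular if it is not a zero divisor (equivalently some coefficient is a unit), primary if it generates a primary ideal, and basic irreducible if it is irreducible and its reduction modulo $p$ is irreducible. The socle of a commutative ring is the sum of its minimal nonzero ideals; it is simple if it is itself a minimal nonzero ideal. Standing assumption: $f(x)\in GR(p^a,m)[x]$ is a monic regular primary polynomial which is not a unit, written as $f(x)=h(x)^t+p\beta(x)$ with $t\ge 1$, $h(x)$ a monic basic irreducible polynomial with $\overline{h}(x)=h(x)$ (i.e. the coefficients of $h$ lie in $\mathcal{T}_m$), $\beta(x)\in GR(p^a,m)[x]$ and $\deg\beta(x)<t\deg h(x)$. *)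

(* Defs.v *)
From HB Require Import structures.
From mathcomp Require Import all_boot all_algebra.
From mathcomp Require Import boolp classical_sets.

Set Implicit Arguments.
Unset Strict Implicit.
Unset Printing Implicit Defensive.

Import GRing.Theory.
Local Open Scope classical_set_scope.
Local Open Scope ring_scope.

Section CommutativeRing.
Variable S : comNzRingType.
Implicit Types (x y z : S) (I J M : set S).

(* MathComp only equips {poly S} with units when S is an integral domain. *)
Definition invertible x : Prop := exists y, x * y = 1.

Definition irreducible_elt x : Prop :=
  [/\ x <> 0, ~ invertible x
    & forall y z, x = y * z -> invertible y \/ invertible z].

(* Unlike [idealr], this allows the unit ideal: in a field the socle is the
   whole ring. *)
Definition is_ideal I : Prop :=
  [/\ I 0, forall x y, I x -> I y -> I (x + y)
    & forall x y, I y -> I (x * y)].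

Definition ideal_gen x : set S := [set y | exists z, y = z * x].

Definition maximal_ideal M : Prop :=
  [/\ is_ideal M, M <> [set: S]
    & forall J, is_ideal J -> M `<=` J -> J = M \/ J = [set: S]].

Definition primary_ideal I : Prop :=
  [/\ is_ideal I, I <> [set: S]
    & forall x y, I (x * y) -> I x \/ exists2 n, (0 < n)%N & I (y ^+ n)].

Definition minimal_nonzero_ideal I : Prop :=
  [/\ is_ideal I, I <> [set 0]
    & forall J, is_ideal J -> J <> [set 0] -> J `<=` I -> J = I].

Definition socle : set S :=
  [set x | exists2 s : seq S, x = \sum_(y <- s) y &
     forall y, y \in s -> exists2 I, minimal_nonzero_ideal I & I y].

End CommutativeRing.

Arguments socle {S}.

(* These properties determine GR(p^a, m) up to isomorphism. *)
Record is_galois_ring (p a m : nat) (R : finComNzRingType) : Prop := {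
  galois_char : forall n : nat, (n%:R == 0 :> R) = (p ^ a %| n)%N;
  galois_card : #|R| = (p ^ (a * m))%N;
  galois_local : forall M : set R, maximal_ideal M <-> M = ideal_gen p%:R
}.

(* red presents F as the residue ring R / <p>. *)
Record is_reduction_mod (p : nat) (R : finComNzRingType) (F : finFieldType)
    (red : {rmorphism R -> F}) : Prop := {
  red_surj : forall y, exists x, red x = y;
  red_ker : forall x, red x = 0 <-> ideal_gen p%:R x
}.

(* {0, 1, zeta, ..., zeta ^ (q - 2)} *)
Definition teichmuller (R : finComNzRingType) (q : nat) (zeta : R) : {pred R} :=
  [pred x | x \in 0 :: [seq zeta ^+ i | i <- iota 0 (q - 1)]].

Definition basic_irreducible (R : finComNzRingType) (F : finFieldType)
    (red : {rmorphism R -> F}) (h : {poly R}) : Prop :=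
  irreducible_elt h /\ irreducible_poly (map_poly red h).

(* {poly %/ f} is the quotient by mk_monic f, which falls back to 'X when f is
   not monic of positive degree. *)
Lemma mk_monic_nonunit (R : comNzRingType) (f : {poly R}) :
  f \is monic -> ~ invertible f -> mk_monic f = f.
Proof.
move=> fm fu; rewrite /mk_monic fm andbT; case: ltnP => // /size1_polyC fE.
case: fu; exists 1; rewrite mulr1 fE; congr polyC.
by move/monicP: fm; rewrite {1}fE lead_coefC.
Qed.

(* Main.v *)
Require Import Defs.
From mathcomp Require Import all_boot all_algebra.
From mathcomp Require Import boolp classical_sets.
Import GRing.Theory.
Local Open Scope ring_scope.

(** A nonzero element [s] of a commutative ring that is a multiple of every
    nonzero element lies in every nonzero ideal; hence [<s>] is the only minimal
    nonzero ideal, and it is the socle ([socle_eq_of_dvd_all]). It remains to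
    see that [s = p ^ (a - 1) h ^ (t - 1)] is such an element modulo [f].

    A nonzero class is represented by a nonzero polynomial [z] of degree less
    than [deg f]. Take out of [z] the largest possible power of [p] and multiply
    by the power that is missing to reach [p ^ (a - 1)]: a multiple of [z] is
    [p ^ (a - 1) g], where the reduction of [g] modulo [p] is nonzero and, for
    degree reasons, not divisible by the reduction [H ^ t] of [f]
    ([factor_power_of_uniformizer]). Since [H] is irreducible over the residue
    field, the gcd of the reduction of [g] and [H ^ t] divides [H ^ (t - 1)]
    ([prime_power_pred_in_ideal]). A Bezout relation for [H ^ (t - 1)] lifts to
    [h ^ (t - 1)] up to a multiple of [p], and multiplication by [p ^ (a - 1)]
    removes this error ([socle_generator_in_ideal]). Finally [s] is nonzero
    modulo [f], because it has leading coefficient [p ^ (a - 1)], which is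
    nonzero, and degree less than [deg f]. *)

(** Such an [s] lies in every nonzero ideal, so no minimal nonzero ideal other
    than [<s>] contributes to the sum that defines the socle. *)
Lemma socle_eq_of_dvd_all (S : comNzRingType) (s : S) :
  s <> 0 -> (forall z, z <> 0 -> ideal_gen z s) ->
  minimal_nonzero_ideal (socle : set S) /\ (socle : set S) = ideal_gen s.
Proof.
move=> s_neq0 s_dvd.
have s_in : ideal_gen s s by exists 1; rewrite mul1r.
have gen_ideal : is_ideal (ideal_gen s).
  split; first by exists 0; rewrite mul0r.
    by move=> _ _ [u ->] [v ->]; exists (u + v); rewrite mulrDl.
  by move=> x _ [u ->]; exists (x * u); rewrite mulrA.
have gen_sub (J : set S) :
    is_ideal J -> J <> [set 0]%classic -> (ideal_gen s `<=` J)%classic.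
  move=> [J0 JD JM] J_neq0.
  have [z Jz z_neq0] : exists2 z, J z & z <> 0.
    apply: contrapT => J_triv; apply: J_neq0; apply/seteqP.
    split=> [z Jz|_ -> //]; apply: contrapT => z_neq0.
    by apply: J_triv; exists z.
  move=> _ [u ->]; apply: (JM).
  by have [v ->] := s_dvd z z_neq0; apply: JM.
have gen_neq0 : ideal_gen s <> [set 0]%classic.
  by move=> gen0; apply: s_neq0; move: s_in; rewrite gen0.
have gen_min : minimal_nonzero_ideal (ideal_gen s).
  split=> // J J_ideal J_neq0 J_sub; apply/seteqP; split=> //.
  exact: gen_sub.
suff socE : (socle : set S) = ideal_gen s by rewrite socE.
apply/seteqP; split=> [x [r -> r_min]|x x_in]; last first.
  exists [:: x]; first by rewrite big_seq1.
  by move=> y; rewrite inE => /eqP ->; exists (ideal_gen s).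
have [gen0 genD _] := gen_ideal.
rewrite big_seq; apply: big_ind => // y /r_min [I [I_ideal I_neq0 I_min] Iy].
by rewrite (I_min _ gen_ideal gen_neq0 (gen_sub I I_ideal I_neq0)).
Qed.

(** As [q] is irreducible, the ideals that contain [q ^+ t.+1] form the chain of
    the [<q ^+ k>] with [k <= t.+1]. Adding [g] to [<q ^+ t.+1>] moves strictly
    up this chain, hence reaches at least [<q ^+ t>]. *)
Lemma prime_power_pred_in_ideal (F : fieldType) (q : {poly F}) (t : nat)
    (g : {poly F}) :
  irreducible_poly q -> ~~ (q ^+ t.+1 %| g)%R ->
  exists u v, u * g + v * q ^+ t.+1 = q ^+ t.
Proof.
move=> q_irr; elim: t g => [|t IHt] g ndvd_g.
  have : coprimep g q.
    by rewrite coprimep_sym irreducible_poly_coprime // -(expr1 q).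
  by case/Bezout_eq1_coprimepP=> -[u v] /= uv1; exists u, v.
have [/dvdpP [g' g'E]|ndvd_q] := boolP (q %| g)%R.
  have ndvd_g' : ~~ (q ^+ t.+1 %| g')%R.
    by move: ndvd_g; rewrite g'E exprSr dvdp_mul2r // irredp_neq0.
  have [u [v uvE]] := IHt g' ndvd_g'; exists u, v.
  by rewrite g'E [q ^+ t.+2]exprSr !mulrA -mulrDl uvE exprSr.
have : coprimep g (q ^+ t.+2).
  by rewrite coprimep_expr // coprimep_sym irreducible_poly_coprime.
case/Bezout_eq1_coprimepP=> -[u v] /= uv1.
exists (q ^+ t.+1 * u), (q ^+ t.+1 * v).
by rewrite -!mulrA -mulrDr uv1 mulr1.
Qed.

Lemma map_poly_surj (R F : nzRingType) (red : {rmorphism R -> F}) :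
  (forall y, exists x, red x = y) ->
  forall g : {poly F}, exists G : {poly R}, map_poly red G = g.
Proof.
move=> /choice [lift liftK] g; exists (\poly_(i < size g) lift g`_i).
apply/polyP => i; rewrite coef_map coef_poly /=.
by case: ltnP => [_|ig]; rewrite ?liftK // rmorph0 nth_default.
Qed.

Lemma map_poly_ker (R : comNzRingType) (F : nzRingType)
    (red : {rmorphism R -> F}) (pi : R) (G : {poly R}) :
  (forall x, red x = 0 <-> ideal_gen pi x) -> map_poly red G = 0 ->
  exists2 H : {poly R}, (size H <= size G)%N & G = pi *: H.
Proof.
move=> red_ker G0.
have /choice [c cE] (i : nat) : exists y, G`_i = y * pi.
  by apply/red_ker; rewrite -coef_map G0 coef0.
exists (\poly_(i < size G) c i); first exact: size_poly.
apply/polyP => i; rewrite coefZ coef_poly.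
by case: ltnP => [_|iG]; [rewrite cE mulrC | rewrite mulr0 nth_default].
Qed.

(** The process of taking out factors [pi] stops, because a multiple of
    [pi ^+ n.+1] is zero. *)
Lemma factor_power_of_uniformizer (R : comNzRingType) (F : nzRingType)
    (red : {rmorphism R -> F}) (pi : R) (n : nat) (z : {poly R}) :
  (forall x, red x = 0 <-> ideal_gen pi x) -> pi ^+ n.+1 = 0 -> z != 0 ->
  exists (k : nat) (g : {poly R}),
    [/\ (k <= n)%N, (size g <= size z)%N, map_poly red g != 0
      & z = pi ^+ k *: g].
Proof.
move=> red_ker pi_nil z_neq0; apply: contrapT => no_factor.
have allk k : (k <= n.+1)%N ->
    exists2 g : {poly R}, (size g <= size z)%N & z = pi ^+ k *: g.
  elim: k => [_|k IHk k_lt]; first by exists z; rewrite ?expr0 ?scale1r.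
  have [g g_size zE] := IHk (ltnW k_lt).
  have [/(map_poly_ker _ _ _ _ _ red_ker) [g' g'_size gE]|g_red] :=
    eqVneq (map_poly red g) 0; last first.
    by case: no_factor; exists k, g.
  by exists g'; rewrite ?(leq_trans g'_size) // zE gE scalerA exprSr.
have [g _ zE] := allk n.+1 (leqnn _).
by move: z_neq0; rewrite zE pi_nil scale0r eqxx.
Qed.

(** The relation between [z], [f] and [h ^+ t] is found over the residue field.
    Lifts of its coefficients satisfy it only up to a multiple of [pi], which
    vanishes after multiplication by [pi ^+ n]. *)
Lemma socle_generator_in_ideal (R : comNzRingType) (F : fieldType)
    (red : {rmorphism R -> F}) (pi : R) (n t : nat) (f h z : {poly R}) :
  (forall y, exists x, red x = y) ->
  (forall x, red x = 0 <-> ideal_gen pi x) ->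
  pi ^+ n.+1 = 0 ->
  f \is monic -> irreducible_poly (map_poly red h) ->
  map_poly red f = map_poly red h ^+ t.+1 ->
  z != 0 -> (size z < size f)%N ->
  exists w v, w * z + v * f = pi ^+ n *: h ^+ t.
Proof.
move=> red_surj red_ker pi_nil f_monic h_irr f_red z_neq0 z_size.
have [k [g [k_le g_size g_red zE]]] :=
  factor_power_of_uniformizer _ _ _ _ _ _ red_ker pi_nil z_neq0.
(* The reduction of the monic [f] keeps its degree, which exceeds that of [g]. *)
have ndvd_g : ~~ (map_poly red h ^+ t.+1 %| map_poly red g)%R.
  rewrite -f_red; apply/negP => /(dvdp_leq g_red); apply/negP; rewrite -ltnNge.
  rewrite (size_map_poly_id0 (p := f)) ?(monicP f_monic) ?rmorph1 ?oner_neq0 //.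
  by rewrite (leq_ltn_trans (size_poly _ _)) // (leq_ltn_trans g_size).
have [u' [v' uvE]] := prime_power_pred_in_ideal _ _ _ _ h_irr ndvd_g.
have [u uE] := map_poly_surj _ _ _ red_surj u'.
have [v vE] := map_poly_surj _ _ _ red_surj v'.
(* [e] measures the failure of the lifted relation. *)
have /(map_poly_ker _ _ _ _ _ red_ker) [e _ eE] :
    map_poly red (u * g + v * f - h ^+ t) = 0.
  by rewrite rmorphB rmorphD !rmorphM /= rmorphXn uE vE f_red uvE subrr.
(* The missing power of [pi] turns [z = pi ^+ k *: g] into [pi ^+ n *: g]. *)
exists (pi ^+ (n - k) *: u), (pi ^+ n *: v).
rewrite zE -!scalerAl -scalerAr scalerA -exprD subnK // -scalerDr.
apply/eqP; rewrite -subr_eq0 -scalerBr eE scalerA -exprSr pi_nil.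
by rewrite scale0r.
Qed.

Theorem lemma3p3 (p a m : nat) (R : finComNzRingType) (F : finFieldType)
    (red : {rmorphism R -> F}) (zeta : R) (t : nat) (f h beta : {poly R})
    (p_prime : prime p) (a_ge1 : (1 <= a)%N) (m_ge1 : (1 <= m)%N)
    (R_galois : is_galois_ring p a m R)
    (F_card : #|F| = (p ^ m)%N)
    (red_mod : is_reduction_mod p red)
    (zeta_order : (p ^ m - 1).-primitive_root zeta)
    (f_monic : f \is monic)
    (f_regular : GRing.lreg f)
    (f_primary : primary_ideal (ideal_gen f))
    (f_nonunit : ~ invertible f)
    (t_ge1 : (1 <= t)%N)
    (h_monic : h \is monic)
    (h_basic_irreducible : basic_irreducible red h)
    (h_teichmuller : h \is a polyOver (teichmuller (p ^ m) zeta))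
    (beta_deg : (size beta <= t * (size h).-1)%N)
    (f_eq : f = h ^+ t + p%:R *: beta) :
  minimal_nonzero_ideal (socle : set {poly %/ f}) /\
  (socle : set {poly %/ f}) =
    ideal_gen (in_qpoly f ((p ^ (a - 1))%:R *: h ^+ (t - 1))).
Proof.
have [red_surj red_ker] := red_mod.
have [_ h_irr] := h_basic_irreducible.
have f_mk : mk_monic f = f by exact: mk_monic_nonunit.
case: t t_ge1 f_eq beta_deg => // t _ f_eq _.
case: a a_ge1 R_galois => // n _ [R_char _ _].
rewrite !subn1 !succnK natrX.
have p_nil : (p%:R : R) ^+ n.+1 = 0 by apply/eqP; rewrite -natrX R_char.
have p_max : (p%:R : R) ^+ n != 0.
  by rewrite -natrX R_char dvdn_Pexp2l ?ltnn ?prime_gt1.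
have red_p : red p%:R = 0 by apply/red_ker; exists 1; rewrite mul1r.
have f_red : map_poly red f = map_poly red h ^+ t.+1.
  by rewrite f_eq rmorphD /= rmorphXn map_polyZ /= red_p scale0r addr0.
have size_red (g : {poly R}) : g \is monic -> size (map_poly red g) = size g.
  by move=> /monicP gm; rewrite size_map_poly_id0 // gm rmorph1 oner_neq0.
have ht_size : (size (h ^+ t)%R < size f)%N.
  rewrite -(size_red f) // -(size_red (h ^+ t)) ?monic_exp // f_red rmorphXn /=.
  have [h_size _] := h_irr.
  rewrite exprS size_mul ?expf_neq0 ?irredp_neq0 //.
  by case: size h_size => [|[|d]] //= _; rewrite addSn ltnS leq_addl.
apply: socle_eq_of_dvd_all => [/(congr1 (@polyn _ _))|z z_neq0].
  rewrite in_qpoly_small ?f_mk; last first.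
    exact: leq_ltn_trans (size_scale_leq _ _) ht_size.
  move=> /(congr1 (fun q : {poly R} => q`_(size (h ^+ t)).-1)) /eqP.
  rewrite coefZ -lead_coefE (monicP (monic_exp _ h_monic)) mulr1 coef0.
  exact/negP.
have [||w [v wvE]] := socle_generator_in_ideal _ _ _ _ n t f h (val z)
  red_surj red_ker p_nil f_monic h_irr f_red.
- by apply/eqP => z0; apply: z_neq0; apply: val_inj.
- have f_size : size (mk_monic f) = size f by rewrite f_mk.
  by rewrite -f_size size_mk_monic.
exists (in_qpoly f w); rewrite -wvE in_qpolyD !in_qpolyM.
have -> : in_qpoly f f = 0.
  by apply: val_inj; rewrite /= f_mk Pdiv.RingMonic.rmodpp.
have -> : in_qpoly f (val z) = z.
  by apply: val_inj; rewrite [LHS]in_qpoly_small // size_mk_monic.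
by rewrite mulr0 addr0.
Qed.
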